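(* Let $X$ be an infinite dimensional Banach space over the field $\mathbb{F}$ (where $\mathbb{F}=\mathbb{R}$ or $\mathbb{F}=\mathbb{C}$), and let $H$ be a Hamel base of $X$. Then $H$ is not linearly Borel with respect to $X$; that is, it is not the case that for every positive integer $n$ the set of all linear combinations with $n$ vectors of $H$ is a Borel subset of $X$.
   Context: A Hamel base of $X$ is a basis of $X$ as a vector space over $\mathbb{F}$ in the algebraic sense: a linearly independent subset whose finite linear combinations give all of $X$. Borel subsets of $X$ are taken with respect to the norm topology. For a subset $S\subseteq X$ and a positive integer $n$, the set of all linear combinations with $n$ vectors of $S$ (linear combinations of length $n$) is $$S_n:=\Big\{\sum_{i=1}^n \alpha_i s_i:\ \alpha_1,\ldots,\alpha_n\in\mathbb{F}\setminus\{0\},\ s_1,\ldots,s_n\in S \text{ pairwise distinct}\Big\}.$$ The set $S$ is called linearly Borel (with respect to $X$) if for every positive integer $n$ the set $S_n$ is a Borel subset of $X$. *)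

(* Defs.v *)
From HB Require Import structures.
From mathcomp Require Import all_boot all_order all_algebra.
From mathcomp Require Import all_classical all_reals all_analysis.
From mathcomp Require Import complex.

Set Implicit Arguments.
Unset Strict Implicit.
Unset Printing Implicit Defensive.

Import GRing.Theory.
Import numFieldNormedType.Exports.

Local Open Scope classical_set_scope.
Local Open Scope ring_scope.

(* The scalars and vectors are families indexed by 'I_n; for the vectors,
   "pairwise distinct" is injectivity of the family. *)
Definition lin_combs (K : fieldType) (X : lmodType K) (S : set X) (n : nat) :
    set X :=
  [set x | exists (a : 'I_n -> K) (s : 'I_n -> X),
    [/\ forall i, a i != 0, forall i, S (s i), injective s &
        x = \sum_(i < n) a i *: s i]].

Definition lin_span (K : fieldType) (X : lmodType K) (S : set X) : set X :=
  [set x | exists (n : nat) (a : 'I_n -> K) (s : 'I_n -> X),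
    (forall i, S (s i)) /\ x = \sum_(i < n) a i *: s i].

Definition lin_indep (K : fieldType) (X : lmodType K) (S : set X) : Prop :=
  forall (n : nat) (a : 'I_n -> K) (s : 'I_n -> X),
    (forall i, S (s i)) -> injective s ->
    \sum_(i < n) a i *: s i = 0 -> forall i, a i = 0.

Definition hamel_base (K : fieldType) (X : lmodType K) (H : set X) : Prop :=
  lin_indep H /\ lin_span H = setT.

Definition infinite_dimensional (K : fieldType) (X : lmodType K) : Prop :=
  ~ exists2 B : set X, finite_set B & lin_span B = setT.

Definition borel_set (X : topologicalType) (A : set X) : Prop :=
  <<s [set U : set X | open U] >> A.

Definition linearly_borel (K : numFieldType) (X : normedModType K)
    (S : set X) : Prop :=
  forall n : nat, (0 < n)%N -> borel_set (lin_combs S n).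

(* Main.v *)
Require Import Defs.
From HB Require Import structures.
From mathcomp Require Import all_boot all_order all_algebra.
From mathcomp Require Import all_classical all_reals all_analysis.
From mathcomp Require Import complex.

Set Implicit Arguments.
Unset Strict Implicit.
Unset Printing Implicit Defensive.

Import Order.TTheory GRing.Theory Num.Theory.
Import numFieldNormedType.Exports.

Local Open Scope classical_set_scope.
Local Open Scope ring_scope.

(** Suppose that every [lin_combs H n] with [n > 0] is Borel, so that it has the
    Baire property.  These sets cover [X] minus the origin and [X] is a Baire
    space, so one of them, say [A := lin_combs H n], coincides on a comeager set
    with a nonempty open set.  Pettis' argument then shows that [A - A] absorbs [X]:
    every vector [v] has a nonzero multiple [c *: v] that is a difference of two
    elements of [A] ([baire_difference_absorbing]), hence a combination of at
    most [2 * n] vectors of [H].  The sum of [2 * n + 1] distinct vectors of the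
    infinite set [H] contradicts this, because a combination of distinct
    independent vectors with nonzero coefficients cannot be rewritten with fewer
    vectors ([lin_indep_leq_length]).

    The argument is carried out over any numeric field [K] whose sequence
    [1 / (n + 1)] is eventually below every positive element; this condition
    makes complete normed spaces over [K] Baire spaces ([complete_baire]), and
    both the real and the complex numbers satisfy it. *)

(** * Baire category *)

(** The Baire category theorem, for the real and the complex scalars alike. *)
Lemma complete_baire (K : numFieldType) (T : completePseudoMetricType K)
    (F : nat -> set T) :
  (forall e : K, 0 < e -> exists n, n.+1%:R^-1 < e) ->
  (forall n, open (F n) /\ dense (F n)) -> dense (\bigcap_n F n).
Proof.
move=> archK odF D D0 oD.
(* The doubled radius leaves room for limits of points of the smaller ball. *)
have shrink (n : nat) (O : set T) : open O -> O !=set0 -> exists b : T * K,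
    [/\ 0 < b.2, b.2 < n.+1%:R^-1 & ball b.1 (b.2 + b.2) `<=` O `&` F n].
  move=> oO O0; have [oF dF] := odF n.
  have [a OFa] := dF _ O0 oO.
  have /nbhs_ballP[/= e e0 aeO] : nbhs a (O `&` F n).
    by apply: open_nbhs_nbhs; split => //; exact: openI.
  have u0 : 0 < n.+2%:R^-1 :> K by rewrite invr_gt0.
  (* [K] may be only partially ordered, so [Num.min] needs comparability. *)
  pose r := Num.min (e / 2) n.+2%:R^-1.
  have e20 : 0 < e / 2 by rewrite divr_gt0.
  have cmp : (e / 2 >=< n.+2%:R^-1)%O.
    by apply: real_comparable; exact: gtr0_real.
  exists (a, r); split => /=.
  - by rewrite comparable_lt_min// e20 u0.
  - rewrite comparable_gt_min//; apply/orP; right.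
    by rewrite ltf_pV2 ?posrE// ltr_nat.
  - apply: subset_trans aeO; apply: le_ball.
    by rewrite [leRHS]splitr lerD// comparable_ge_min// lexx.
have step (z : nat * (T * K)) : exists b : T * K, 0 < z.2.2 ->
    [/\ 0 < b.2, b.2 < z.1.+2%:R^-1 &
        ball b.1 (b.2 + b.2) `<=` (ball z.2.1 z.2.2)° `&` F z.1.+1].
  have [z0|] := pselect (0 < z.2.2); last by move=> z0; exists z.2 => /z0.
  have [//||b Pb] := shrink z.1.+1 (ball z.2.1 z.2.2)°; last by exists b.
  - exact: open_interior.
  - by exists z.2.1; exact: nbhsx_ballx.
have [f Pf] := choice step.
have [b0 [b00 b01 b0D]] := shrink 0%N D oD D0.
pose b := fix b n := if n is p.+1 then f (p, b p) else b0.
have b_gt0 n : 0 < (b n).2.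
  by elim: n => [//|n ih]; have [] := Pf (n, b n) ih.
have b_lt n : (b n).2 < n.+1%:R^-1.
  by case: n => [//|n]; have [] := Pf (n, b n) (b_gt0 n).
have bF n : ball (b n).1 ((b n).2 + (b n).2) `<=` F n.
  case: n => [x /b0D[]//|n].
  by have [_ _ h] := Pf (n, b n) (b_gt0 n); move=> x /h[].
have bS n : ball (b n.+1).1 (b n.+1).2 `<=` ball (b n).1 (b n).2.
  have [_ _ h] := Pf (n, b n) (b_gt0 n); move=> x bx.
  apply: interior_subset; apply: (h _ _).1.
  by apply: le_ball bx; rewrite lerDl; exact: (ltW (b_gt0 n.+1)).
have bM n m : (n <= m)%N -> ball (b n).1 (b n).2 (b m).1.
  move=> nm; suff h : ball (b m).1 (b m).2 `<=` ball (b n).1 (b n).2.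
    by apply: h; exact: ballxx.
  elim: m nm => [|m ih]; first by rewrite leqn0 => /eqP ->.
  rewrite leq_eqVlt => /orP[/eqP ->//|]; rewrite ltnS => /ih.
  by apply: subset_trans; exact: bS.
have : cvg ((fun n => (b n).1) @ \oo).
  apply: cauchy_cvg; apply: cauchy_exP => e e0.
  have [n ne] := archK e e0.
  exists (b n).1; exists n => // m /= nm.
  by apply: le_ball (bM _ _ nm); rewrite ltW// (lt_trans (b_lt n)).
move=> /cvg_ex[l bl].
have lb n : ball (b n).1 ((b n).2 + (b n).2) l.
  have [m _ mP] : \forall m \near \oo, ball l (b n).2 (b m).1.
    by apply: bl; exact: nbhsx_ballx.
  apply: (ball_triangle (bM n (maxn n m) (leq_maxl _ _))).
  by apply: ball_sym; apply: mP => /=; exact: leq_maxr.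
exists l; split; first by have [] := b0D l (lb 0%N).
by move=> n _; apply: bF; exact: lb.
Qed.

Lemma open_dense_setT (T : topologicalType) : open [set: T] /\ dense [set: T].
Proof. by split; [exact: openT | move=> O O0 _; rewrite setIT]. Qed.

(** * The Baire property of Borel sets *)

(** [A] has the Baire property: it agrees with an open set [U] on a countable
    intersection of open dense sets, that is, up to a meager set. *)
Definition has_baire_property (T : topologicalType) (A : set T) : Prop :=
  exists (U : set T) (F : nat -> set T),
    [/\ open U, forall n, open (F n) /\ dense (F n) &
        forall x, (\bigcap_n F n) x -> (A x <-> U x)].

(** The complement of this set is the boundary of [U]. *)
Lemma open_dense_interiorC (T : topologicalType) (U : set T) :
  open U -> open (U `|` (~` U)°) /\ dense (U `|` (~` U)°).
Proof.
move=> oU; split; first by apply: openU => //; exact: open_interior.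
move=> O [x Ox] oO.
have [[y [Oy Uy]]|OU] := pselect (O `&` U !=set0); first by exists y; split; [|left].
exists x; split => //; right.
apply: filterS (open_nbhs_nbhs (conj oO Ox)) => y Oy Uy.
by apply: OU; exists y.
Qed.

Lemma has_baire_property_setC (T : topologicalType) (A : set T) :
  has_baire_property A -> has_baire_property (~` A).
Proof.
move=> [U [F [oU odF AU]]].
exists (~` U)°, (fun n => if n is k.+1 then F k else U `|` (~` U)°); split.
- exact: open_interior.
- by case=> [|k]; [exact: open_dense_interiorC | exact: odF].
move=> x Fx.
have {AU} AU : A x <-> U x by apply: AU => n _; exact: (Fx n.+1).
split=> [nAx|/interior_subset nUx /AU//].
by case: (Fx 0%N Logic.I) => // /AU.
Qed.

Lemma has_baire_property_bigcup (T : topologicalType) (A : nat -> set T) :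
  (forall n, has_baire_property (A n)) -> has_baire_property (\bigcup_n A n).
Proof.
move=> /choice[U /choice[F UF]].
exists (\bigcup_n U n).
exists (fun k => if unpickle k is Some (i, j) then F i j else setT); split.
- by apply: bigcup_open => n _; have [] := UF n.
- move=> k; case: unpickle => [[i j]|]; first by have [_ h _] := UF i; exact: h.
  exact: open_dense_setT.
move=> x Fx.
have AU n : A n x <-> U n x.
  have [_ _] := UF n; apply => j _.
  by have := Fx (pickle (n, j)) Logic.I; rewrite pickleK.
by split=> -[n _ /AU h]; exists n.
Qed.

Lemma borel_has_baire_property (T : topologicalType) (A : set T) :
  borel_set A -> has_baire_property A.
Proof.
apply: smallest_sub.
  have has0 : has_baire_property (@set0 T).
    exists set0, (fun=> setT); split => //; first exact: open0.
    by move=> _; exact: open_dense_setT.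
  split => //.
  - by move=> B; rewrite setTD; exact: has_baire_property_setC.
  - by move=> B; exact: has_baire_property_bigcup.
move=> U oU; exists U, (fun=> setT); split => //.
by move=> _; exact: open_dense_setT.
Qed.

(** * Lengths of linear combinations *)

(** Equal vectors of a combination are collected along a list [r] without
    repetitions. *)
Lemma sum_collect (K : fieldType) (X : lmodType K) (r : seq X) (n : nat)
    (a : 'I_n -> K) (s : 'I_n -> X) :
  uniq r -> {subset codom s <= r} ->
  \sum_(h <- r) (\sum_(i < n | s i == h) a i) *: h = \sum_(i < n) a i *: s i.
Proof.
move=> ur sr; under eq_bigr do rewrite scaler_suml.
rewrite (exchange_big_dep xpredT)//=; apply: eq_bigr => i _.
rewrite -big_filter (_ : [seq h <- r | _] = [:: s i]) ?big_seq1//.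
rewrite -(@filter_pred1_uniq _ r (s i)) ?sr ?codom_f//.
by apply: eq_filter => h /=; rewrite eq_sym.
Qed.

(** The vectors [s i] need not be distinct, and the [a i] may vanish. *)
Lemma lin_indep_leq_length (K : fieldType) (X : lmodType K) (S : set X)
    (m n : nat) (a : 'I_m -> K) (s : 'I_m -> X) (b : 'I_n -> K)
    (t : 'I_n -> X) :
  lin_indep S -> (forall i, S (s i)) -> (forall j, S (t j)) -> injective t ->
  (forall j, b j != 0) ->
  \sum_(i < m) a i *: s i = \sum_(j < n) b j *: t j -> (n <= m)%N.
Proof.
move=> indS Ss St injt b0 st.
(* Each [t j] occurs among the [s i], since its coefficient is not zero. *)
suff ts : {subset codom t <= codom s}.
  have := uniq_leq_size _ ts; rewrite !size_codom !card_ord; apply.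
  by apply/injectiveP.
move=> _ /codomP[j0 ->]; apply: contraT => ts; exfalso.
pose r := undup (codom s ++ codom t).
pose f h := \sum_(i < m | s i == h) a i - \sum_(j < n | t j == h) b j.
have f0 : \sum_(h <- r) f h *: h = 0.
  under eq_bigr do rewrite /f scalerBl.
  rewrite sumrB !sum_collect ?undup_uniq ?st ?subrr// => h hr;
    by rewrite mem_undup mem_cat hr ?orbT.
have tr : t j0 \in r by rewrite mem_undup mem_cat codom_f orbT.
have rS h : h \in r -> S h.
  by rewrite mem_undup mem_cat => /orP[] /codomP[i ->].
have rinj : injective (tnth (in_tuple r)) by apply/tuple_uniqP; exact: undup_uniq.
rewrite big_tnth in f0.
have := indS _ (fun i => f (tnth (in_tuple r) i)) _ _ rinj f0.
have /tnthP[k tk] : t j0 \in in_tuple r by [].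
move=> /(_ (fun i => rS _ (mem_tnth i (in_tuple r)))) /(_ k).
rewrite -tk /f big1 => [|i /eqP sit]; last by rewrite -sit codom_f in ts.
rewrite (big_pred1 j0) => [|j]; last by rewrite (inj_eq injt).
by rewrite sub0r => /eqP; rewrite oppr_eq0 (negbTE (b0 j0)).
Qed.

Lemma hamel_base_infinite (K : fieldType) (X : lmodType K) (H : set X) :
  infinite_dimensional X -> hamel_base H -> infinite_set H.
Proof. by move=> infX [_ spanH] finH; apply: infX; exists H. Qed.

Lemma infinite_set_inj (T : choiceType) (A : set T) (n : nat) :
  infinite_set A -> exists2 t : 'I_n -> T, injective t & forall i, A (t i).
Proof.
move=> /(infinite_set_fset n)[B BA nB].
exists (fun i => tnth (in_tuple (finmap.enum_fset B)) (widen_ord nB i)).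
  move=> i j /tuple_uniqP h; apply/val_inj.
  have /h : uniq (in_tuple (finmap.enum_fset B)) by exact: finmap.fset_uniq.
  by case.
by move=> i; apply: BA => /=; exact: mem_tnth.
Qed.

Lemma hamel_base_lin_combs (K : fieldType) (X : lmodType K) (H : set X) (x : X) :
  hamel_base H -> exists n, lin_combs H n x.
Proof.
move=> [_ spanH].
have [n [a [s [Hs ->]]]] : lin_span H x by rewrite spanH.
pose f h := \sum_(i < n | s i == h) a i.
pose r := [seq h <- undup (codom s) | f h != 0].
exists (size r), (fun i => f (tnth (in_tuple r) i)), (tnth (in_tuple r)); split.
- by move=> i; have := mem_tnth i (in_tuple r); rewrite mem_filter => /andP[].
- move=> i; have := mem_tnth i (in_tuple r).
  by rewrite mem_filter mem_undup => /andP[_ /codomP[k ->]].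
- by apply/tuple_uniqP; rewrite filter_uniq// undup_uniq.
rewrite -(@sum_collect _ _ (undup (codom s))) ?undup_uniq//; last first.
  by move=> h; rewrite mem_undup.
rewrite -(big_tnth _ _ r xpredT (fun h => f h *: h)) big_filter.
rewrite [RHS]big_mkcond/=; apply: eq_bigr => h _.
by rewrite -/(f h); case: eqVneq => [->|//]; rewrite scale0r.
Qed.

(** * Differences of combinations *)

Lemma shift_open (K : numFieldType) (X : normedModType K) (w : X) (O : set X) :
  open O -> open [set y | O (w + y)].
Proof.
move=> oO; apply: (@open_comp _ _ (fun y => w + y)) => // y _.
by apply: cvgD; [exact: cvg_cst | exact: cvg_id].
Qed.

Lemma shift_dense (K : numFieldType) (X : normedModType K) (w : X) (D : set X) :
  dense D -> dense [set y | D (w + y)].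
Proof.
move=> dD O [x Ox] oO.
have [|y [Oy Dy]] := dD [set y | O (- w + y)] _ (shift_open _ oO).
  by exists (w + x); rewrite /= addKr.
by exists (- w + y); split; rewrite //= addNKr.
Qed.

(** Pettis' argument: if [A] agrees with a nonempty open set [U] up to a meager
    set, then every vector has a nonzero multiple in [A - A].  For small [c], the
    open sets [U] and [U - c *: v] meet, and they do so at a point where [A]
    agrees with [U] both at that point and at its translate. *)
Lemma baire_difference_absorbing (K : numFieldType) (X : completeNormedModType K)
    (A U : set X) (F : nat -> set X) :
  (forall e : K, 0 < e -> exists n, n.+1%:R^-1 < e) ->
  open U -> U !=set0 -> (forall n, open (F n) /\ dense (F n)) ->
  (forall x, (\bigcap_n F n) x -> (A x <-> U x)) ->
  forall v : X, exists c : K, exists y, [/\ c != 0, A y & A (c *: v + y)].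
Proof.
move=> archK oU [x Ux] odF AU v.
have [c c0 Uc] : exists2 c : K, c != 0 & U (c *: v + x).
  have h : (fun t : K => t *: v + x) @ (0 : K) --> (0 : K) *: v + x.
    exact: cvgD (@scalel_continuous K X v 0) (cvg_cst x).
  have /h /nbhs_ballP[/= e e0 eU] : nbhs (0 *: v + x) U.
    by rewrite scale0r add0r; exact: open_nbhs_nbhs.
  exists (e / 2); first by rewrite gt_eqF// divr_gt0.
  apply: eU; rewrite -ball_normE /ball_/= sub0r normrN gtr0_norm ?divr_gt0//.
  by rewrite [ltRHS]splitr ltrDl divr_gt0.
pose G n := F n `&` [set y | F n (c *: v + y)].
have /(_ (U `&` [set y | U (c *: v + y)]))[] : dense (\bigcap_n G n).
  apply: complete_baire => // n; have [oF dF] := odF n; split.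
    by apply: openI => //; exact: shift_open.
  by apply: denseI => //; exact: shift_dense.
- by exists x.
- by apply: openI => //; exact: shift_open.
move=> y [[Uy Ucy] Gy]; exists c, y; split => //.
  by apply/AU => // n _; exact: (Gy n Logic.I).1.
by apply/AU => // n _; exact: (Gy n Logic.I).2.
Qed.

Lemma hamel_base_not_linearly_borel (K : numFieldType)
    (X : completeNormedModType K) (H : set X) :
  (forall e : K, 0 < e -> exists n, n.+1%:R^-1 < e) ->
  infinite_dimensional X -> hamel_base H -> ~ linearly_borel H.
Proof.
move=> archK infX hamH borH; have [indH _] := hamH.
have infH := hamel_base_infinite infX hamH.
have /choice[U /choice[F UF]] n : has_baire_property (lin_combs H n.+1).
  by apply: borel_has_baire_property; exact: borH.
(* Otherwise the complement of [0], the union of the sets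
   [lin_combs H n.+1], would be meager. *)
have [n Un] : exists n, U n !=set0.
  apply: contrapT => /forallNP U0.
  pose G k := if unpickle k is Some (i, j) then F i j else setT.
  have dG : dense (\bigcap_k G k).
    apply: complete_baire => // k; rewrite /G.
    case: unpickle => [[i j]|]; first by have [_ h _] := UF i; exact: h.
    exact: open_dense_setT.
  have [t injt Ht] := infinite_set_inj 1 infH.
  have [||x [/= x0 Gx]] := dG (~` [set 0]).
  - exists (t ord0) => /= t0.
    have := indH 1%N (fun=> 1) t Ht injt; rewrite big_ord1 t0 scaler0.
    by move=> /(_ erefl ord0)/eqP; rewrite oner_eq0.
  - rewrite openC; apply: accessible_closed_set1; apply: hausdorff_accessible.
    exact: norm_hausdorff.
  have [[|n] Hx] := hamel_base_lin_combs x hamH.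
    by case: Hx => a [s [_ _ _]]; rewrite big_ord0.
  apply: (U0 n); exists x; have [_ _ h] := UF n; apply/h => // j _.
  by have := Gx (pickle (n, j)) Logic.I; rewrite /G pickleK.
have [oU odF HU] := UF n.
have [t injt Ht] := infinite_set_inj (n.+1 + n.+1).+1 infH.
have [c [y [c0 [a [s [_ Hs _ yE]]] [b [u [_ Hu _ cyE]]]]]] :=
  baire_difference_absorbing archK oU Un odF HU (\sum_i t i).
(* The difference of the two combinations, as one combination of twice the
   length; common vectors are not merged. *)
pose s' (i : 'I_(n.+1 + n.+1)) :=
  match fintype.split i with inl j => u j | inr j => s j end.
pose a' (i : 'I_(n.+1 + n.+1)) :=
  match fintype.split i with inl j => b j | inr j => - a j end.
have : ((n.+1 + n.+1).+1 <= n.+1 + n.+1)%N.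
  apply: (@lin_indep_leq_length _ _ _ _ _ a' s' (fun=> c) t indH) => //.
    by move=> i; rewrite /s'; case: fintype.split.
  rewrite -scaler_sumr -[RHS](addrK y) {}cyE {}yE big_split_ord/= -sumrN.
  congr (_ + _); apply: eq_bigr => i _; rewrite /a' /s'.
    by rewrite (unsplitK (inl i)).
  by rewrite (unsplitK (inr i)) scaleNr.
by rewrite ltnn.
Qed.

Lemma archimedean_invn (K : archiRealFieldType) (e : K) :
  0 < e -> exists n, n.+1%:R^-1 < e.
Proof.
move=> e0; exists (Num.truncn e^-1).
by rewrite -[ltRHS]invrK ltf_pV2 ?posrE ?invr_gt0// truncnS_gt.
Qed.

Lemma archimedean_invn_complex (R : realType) (e : complex R) :
  0 < e -> exists n, n.+1%:R^-1 < e.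
Proof.
case: e => a b; rewrite ltcE/= => /andP[/eqP -> /archimedean_invn[n na]].
exists n; rewrite -[Complex a 0]/(a%:C%C).
by rewrite -(rmorph_nat (real_complex R)) -fmorphV ltcR.
Qed.

Theorem mainTheorem1 (R : realType) :
  (forall (X : completeNormedModType R) (H : set X),
     infinite_dimensional X -> hamel_base H -> ~ linearly_borel H) /\
  (forall (X : completeNormedModType (complex R)) (H : set X),
     infinite_dimensional X -> hamel_base H -> ~ linearly_borel H).
Proof.
split=> X H; apply: hamel_base_not_linearly_borel.
- exact: archimedean_invn.
- exact: archimedean_invn_complex.
Qed.
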